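(* Let $G=(V_G,E_G)$ and $H=(V_H,E_H)$ be graphs, and let $m=\min\{\omega(G)+|V_H|,\ \omega(H)+|V_G|\}$. Then $$m\le \Psi(G\,\nabla H)\le \left\lfloor \frac{\omega(G)+\omega(H)}{2}+\frac{|V_G|+|V_H|}{2}\right\rfloor .$$
   Context: All graphs are finite and simple. A coloring of a graph $G=(V,E)$ is a surjective map $\ell:V\to C$ onto a finite set $C$ of colors; it need not be proper. It is pseudocomplete if for any two distinct colors $i,j\in C$ there is an edge $uv\in E$ with $\{\ell(u),\ell(v)\}=\{i,j\}$. The pseudoachromatic number $\Psi(G)$ is the greatest number of colors used in a pseudocomplete coloring of $G$. $\omega(G)$ is the clique number of $G$. $G\,\nabla H$ is the join: the disjoint union of $G$ and $H$ together with all edges between a vertex of $G$ and a vertex of $H$. *)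

(* Defs.v *)
From mathcomp Require Import all_boot.

Set Implicit Arguments.
Unset Strict Implicit.
Unset Printing Implicit Defensive.

Record sgraph := SGraph {
  vertex :> finType;
  adj : rel vertex;
  adj_sym : symmetric adj;
  adj_irrefl : irreflexive adj
}.

Definition clique (G : sgraph) (K : {set G}) : bool :=
  [forall u in K, forall v in K, (u != v) ==> adj u v].

Definition omega (G : sgraph) : nat :=
  \max_(K : {set G} | clique K) #|K|.

Section Join.
Variables G H : sgraph.

Definition join_adj : rel (G + H)%type := fun x y =>
  match x, y with
  | inl u, inl v => adj u v
  | inr u, inr v => adj u v
  | _, _ => true
  end.

Lemma join_adj_sym : symmetric join_adj.
Proof. by move=> [u|u] [v|v] //=; rewrite adj_sym. Qed.

Lemma join_adj_irrefl : irreflexive join_adj.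
Proof. by move=> [u|u] /=; rewrite adj_irrefl. Qed.

Definition join : sgraph := SGraph join_adj_sym join_adj_irrefl.

End Join.

Definition coloring (G : sgraph) (C : finType) (l : G -> C) : bool :=
  [forall c : C, exists v : G, l v == c].

Definition pseudocomplete (G : sgraph) (C : finType) (l : G -> C) : bool :=
  [forall i : C, forall j : C, (i != j) ==>
    [exists u : G, exists v : G, adj u v && ([set l u; l v] == [set i; j])]].

(* A coloring is surjective, so it uses at most #|G| colors; [Psi_greatest]
   shows that neither this bound nor the choice of 'I_k as the set of colors
   loses anything. *)
Definition Psi (G : sgraph) : nat :=
  \max_(k < #|G|.+1 | [exists l : {ffun G -> 'I_k},
                         coloring l && pseudocomplete l]) k.

Lemma coloring_card (G : sgraph) (C : finType) (l : G -> C) :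
  coloring l -> #|C| <= #|G|.
Proof.
move=> /forallP sl; have <- : #|codom l| = #|C|; last exact: leq_image_card.
by apply: eq_card => c; have /existsP[v /eqP <-] := sl c; rewrite codom_f.
Qed.

Lemma Psi_greatest (G : sgraph) :
  (exists (C : finType) (l : G -> C),
      [/\ coloring l, pseudocomplete l & #|C| = Psi G]) /\
  (forall (C : finType) (l : G -> C),
      coloring l -> pseudocomplete l -> #|C| <= Psi G).
Proof.
have ub (C : finType) (l : G -> C) :
    coloring l -> pseudocomplete l -> #|C| <= Psi G.
  move=> cl pl; have kG := coloring_card cl.
  apply: (@leq_bigmax_cond _ _ _ (Ordinal (kG : #|C| < #|G|.+1))).
  apply/existsP; exists [ffun v => enum_rank (l v)]; apply/andP; split.
    apply/forallP => c; have /existsP[v /eqP vc] := forallP cl (enum_val c).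
    by apply/existsP; exists v; rewrite ffunE vc enum_valK.
  apply/forallP => i; apply/forallP => j; apply/implyP => ij.
  have nij : enum_val i != enum_val j by rewrite (inj_eq enum_val_inj).
  have /existsP[u /existsP[v /andP[uv /eqP e]]] :=
    implyP (forallP (forallP pl (enum_val i)) (enum_val j)) nij.
  apply/existsP; exists u; apply/existsP; exists v; rewrite uv !ffunE /=.
  have := congr1 (fun A : {set C} => enum_rank @: A) e.
  by rewrite !imsetU1 !imset_set1 !enum_valK => ->.
split=> //; pose P (k : 'I_#|G|.+1) :=
  [exists l : {ffun G -> 'I_k}, coloring l && pseudocomplete l].
suff /card_gt0P[k0 Pk0] : 0 < #|P|.
  have P0 : 0 < #|P| by apply/card_gt0P; exists k0.
  have [k /existsP[l /andP[cl pl]] kE] := @eq_bigmax_cond _ P (@nat_of_ord _) P0.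
  have -> : Psi G = k by rewrite -kE; apply: eq_bigl.
  by exists 'I_k, l; rewrite card_ord.
apply/card_gt0P; have [G0|/card_gt0P[x _]] := posnP #|G|.
  exists ord0; apply/existsP.
  have nG (v : G) : False by have := card0_eq G0 v; rewrite inE.
  exists [ffun v => match nG v with end].
  by apply/andP; split; apply/forallP => -[].
have k1 : 1 < #|G|.+1 by rewrite ltnS; apply/card_gt0P; exists x.
exists (Ordinal k1); apply/existsP; exists [ffun=> ord0]; apply/andP; split.
  by apply/forallP => c; apply/existsP; exists x; rewrite ffunE [c]ord1.
by apply/forallP => i; apply/forallP => j; rewrite [i]ord1 [j]ord1 eqxx.
Qed.

(* Main.v *)
Require Import Defs.
From mathcomp Require Import all_boot all_order all_algebra.

Set Implicit Arguments.
Unset Strict Implicit.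
Unset Printing Implicit Defensive.

(** Upper bound. In a pseudocomplete coloring of any graph [J], the vertices
    whose color occurs nowhere else form a clique: the only edge that can
    witness a pair of such colors joins the two vertices themselves. Every
    other color occupies at least two vertices, so counting vertices gives
    [2 * Psi J <= #|J| + omega J] ([double_Psi_le]). A clique of a join splits
    into a clique of each side ([omega_join]), and the bound follows.

    Lower bound. By symmetry the smaller of the two numbers may be taken to be
    [omega G + #|H|], which says that a maximum clique [K] of [G] misses at
    least as many vertices as a maximum clique [L] of [H] does. Give pairwise
    distinct colors to all vertices of [K] and of [H], and repeat the color of
    each vertex of [H] outside [L] on a vertex of [G] outside [K]. The only
    pairs of colors not immediately joined by an edge are those of two vertices
    of [H], not both in [L]; one of these colors has a copy in [G], adjacent to
    all of [H] ([Psi_join_ge]). Leftover vertices of [G] may receive any color,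
    which is why it is enough to color part of the graph ([Psi_partial]). *)

Lemma clique_adj (G : sgraph) (K : {set G}) (u v : G) :
  clique K -> u \in K -> v \in K -> u != v -> adj u v.
Proof.
by move=> /forall_inP cK uK vK; move/implyP: (forall_inP (cK u uK) v vK).
Qed.

Lemma cliqueI (G : sgraph) (K : {set G}) :
  {in K &, forall u v, u != v -> adj u v} -> clique K.
Proof.
by move=> cK; apply/forall_inP=> u uK; apply/forall_inP=> v vK;
   apply/implyP; apply: cK.
Qed.

Lemma clique_le_omega (G : sgraph) (K : {set G}) :
  clique K -> #|K| <= omega G.
Proof. exact: (@leq_bigmax_cond _ _ (fun K : {set G} => #|K|)). Qed.

Lemma omega_witness (G : sgraph) :
  exists2 K : {set G}, clique K & #|K| = omega G.
Proof.
have P0 : 0 < #|@clique G|.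
  by apply/card_gt0P; exists set0; apply: cliqueI => u v; rewrite inE.
have [K cK KE] := eq_bigmax_cond (fun K : {set G} => #|K|) P0.
by exists K => //; rewrite -KE.
Qed.

Lemma pseudocomplete_adj (G : sgraph) (C : finType) (l : G -> C) (i j : C) :
  pseudocomplete l -> i != j ->
  exists u v, [/\ adj u v, l u = i & l v = j].
Proof.
move=> /forallP/(_ i)/forallP/(_ j)/implyP pl ij.
have /existsP[u /existsP[v /andP[uv /eqP e]]] := pl ij.
have : i \in [set l u; l v] by rewrite e set21.
have : j \in [set l u; l v] by rewrite e set22.
rewrite !inE => /orP[]/eqP jE /orP[]/eqP iE.
- by rewrite iE jE eqxx in ij.
- by exists v, u; rewrite adj_sym.
- by exists u, v.
- by rewrite iE jE eqxx in ij.
Qed.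

Lemma pseudocompleteI (G : sgraph) (C : finType) (l : G -> C) :
  (forall i j, i != j -> exists u v, [/\ adj u v, l u = i & l v = j]) ->
  pseudocomplete l.
Proof.
move=> pl; apply/forallP=> i; apply/forallP=> j; apply/implyP=> /pl.
case=> u [v [uv <- <-]].
by apply/existsP; exists u; apply/existsP; exists v; rewrite uv eqxx.
Qed.

(** Coloring the remaining vertices destroys no edge that witnesses a pair of
    colors, so they can all take one arbitrary existing color. *)
Lemma Psi_partial (G : sgraph) (C : finType) (l : G -> option C) :
    (forall c, exists v, l v = Some c) ->
    (forall i j, i != j ->
       exists u v, [/\ adj u v, l u = Some i & l v = Some j]) ->
  #|C| <= Psi G.
Proof.
move=> sl pl; have [-> //|/card_gt0P[c0 _]] := posnP #|C|.
apply: ((Psi_greatest G).2 C (fun v => odflt c0 (l v))).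
  by apply/forallP=> c; apply/existsP; have [v lv] := sl c; exists v; rewrite lv.
apply: pseudocompleteI => i j /pl[u [v [uv lu lv]]].
by exists u, v; rewrite lu lv.
Qed.

(** A coloring of a subgraph is a partial coloring of the whole graph. *)
Lemma Psi_mono (G H : sgraph) (f : G -> H) :
  injective f -> (forall u v, adj u v -> adj (f u) (f v)) -> Psi G <= Psi H.
Proof.
move=> fI fadj; have [[C [l [cl pl <-]]] _] := Psi_greatest G.
pose l' (y : H) := omap l [pick x | f x == y].
have l'f x : l' (f x) = Some (l x).
  rewrite /l'; case: pickP => [z /eqP/fI -> //|/(_ x)].
  by rewrite eqxx.
apply: (@Psi_partial H C l').
  move=> c; have /existsP[v /eqP <-] := forallP cl c.
  by exists (f v).
move=> i j /(pseudocomplete_adj pl)[u [v [uv <- <-]]].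
by exists (f u), (f v); split=> //; apply: fadj.
Qed.

Lemma Psi_joinC_le (G H : sgraph) : Psi (join G H) <= Psi (join H G).
Proof.
pose swap (x : join G H) : join H G :=
  match x with inl u => inr u | inr v => inl v end.
apply: (@Psi_mono _ _ swap); first by move=> [x|x] [y|y] //= [->].
by move=> [x|x] [y|y].
Qed.

Lemma partial_surjection (S T : finType) (A : {set S}) (B : {set T}) :
  #|B| <= #|A| ->
  exists c : S -> option T, forall y, y \in B ->
    exists2 x, x \in A & c x = Some y.
Proof.
move=> leBA; exists (fun x => onth (enum B) (index x (enum A))) => y yB.
have iB : index y (enum B) < size (enum B) by rewrite index_mem mem_enum.
have iA : index y (enum B) < size (enum A).
  by apply: leq_trans iB _; rewrite -!cardE.
have /card_gt0P[x0 _] : 0 < #|A|.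
  by rewrite cardE; apply: leq_trans iA.
exists (nth x0 (enum A) (index y (enum B))).
  by rewrite -mem_enum mem_nth.
rewrite index_uniq ?enum_uniq // (onthE _ _) (nth_map y) //.
by rewrite nth_index // mem_enum.
Qed.

(** The set of colors is the disjoint union of [K] and the vertices of [H]; the
    cardinality hypothesis leaves room outside [K] for a second copy of every
    color in [~: L]. *)
Lemma Psi_join_ge (G H : sgraph) (K : {set G}) (L : {set H}) :
  clique K -> clique L -> #|~: L| <= #|~: K| ->
  #|K| + #|H| <= Psi (join G H).
Proof.
move=> cK cL leLK; have [c cP] := partial_surjection leLK.
pose C : finType := ({x | x \in K} + H)%type.
pose l (x : join G H) : option C :=
  match x with
  | inl g => if insub g is Some k then Some (inl k) else omap inr (c g)
  | inr h => Some (inr h)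
  end.
have lK (k : {x | x \in K}) : l (inl (val k)) = Some (inl k).
  by rewrite /l valK.
have lc h : h \notin L -> exists g, l (inl g) = Some (inr h).
  rewrite -in_setC => /cP[g]; rewrite in_setC => gK cg.
  by exists g; rewrite /l insubN // cg.
have <- : #|C| = #|K| + #|H| by rewrite card_sum card_sig.
apply: (@Psi_partial (join G H) C l).
  by move=> [k|h]; [exists (inl (val k))|exists (inr h)].
move=> [k|h] [k'|h'] ij.
- exists (inl (val k)), (inl (val k')); split; rewrite ?lK //=.
  apply: (clique_adj cK (valP k) (valP k')).
  by apply: contra_neq ij => /val_inj ->.
- by exists (inl (val k)), (inr h'); rewrite lK.
- by exists (inr h), (inl (val k')); rewrite lK.
- have [hL|/lc[g lg]] := boolP (h \in L); last first.
    by exists (inl g), (inr h').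
  have [h'L|/lc[g lg]] := boolP (h' \in L); last first.
    by exists (inr h), (inl g).
  exists (inr h), (inr h'); split=> //=.
  exact: (clique_adj cL).
Qed.

Lemma minn_le_Psi_join (G H : sgraph) :
  omega G + #|H| <= omega H + #|G| -> omega G + #|H| <= Psi (join G H).
Proof.
have [K cK <-] := omega_witness G; have [L cL <-] := omega_witness H.
rewrite -(cardsC K) -{1}(cardsC L) addnCA !leq_add2l.
exact: Psi_join_ge cK cL.
Qed.

Lemma omega_join (G H : sgraph) : omega (join G H) <= omega G + omega H.
Proof.
have [S cS <-] := omega_witness (join G H).
pose A := [set u : G | inl u \in S]; pose B := [set v : H | inr v \in S].
have cA : clique A.
  apply: cliqueI => u v; rewrite !inE => uS vS uv.
  exact: (clique_adj cS uS vS).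
have cB : clique B.
  apply: cliqueI => u v; rewrite !inE => uS vS uv.
  exact: (clique_adj cS uS vS).
apply: leq_trans (leq_add (clique_le_omega cA) (clique_le_omega cB)).
by rewrite -sum1_card big_sumType /= !sum1dep_card.
Qed.

(** The vertices that are alone in their color class form a clique, so the
    right-hand side is at least the sum, over the color classes, of their size
    plus the number of such vertices in them. This is at least two for every
    class: one of size one is counted twice. *)
Lemma double_Psi_le (G : sgraph) : (Psi G).*2 <= #|G| + omega G.
Proof.
have [[C [l [cl pl <-]]] _] := Psi_greatest G.
pose S := [set v | [forall w, (l w == l v) ==> (w == v)]].
have SP v w : v \in S -> l w = l v -> w = v.
  by rewrite inE => /forallP/(_ w)/implyP vS lw; apply/eqP/vS/eqP.
have cS : clique S.
  apply: cliqueI => u v uS vS uv.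
  have luv : l u != l v.
    by apply: contraNneq uv => e; rewrite (SP _ _ vS e).
  have [x [y [xy lx ly]]] := pseudocomplete_adj pl luv.
  by rewrite -(SP _ _ uS lx) -(SP _ _ vS ly).
apply: leq_trans (leq_add (leqnn _) (clique_le_omega cS)).
rewrite -[#|vertex G|]sum1_card -[#|S|]sum1_card.
rewrite (partition_big l xpredT) //= [X in _ + X](partition_big l xpredT) //=.
rewrite -big_split -muln2 -sum_nat_const /=; apply: leq_sum => c _.
have /existsP[v /eqP lv] := forallP cl c.
have [vS|] := boolP (v \in S).
  rewrite (bigD1 v) ?lv //= [X in _ + X](bigD1 v) /= ?vS ?lv ?eqxx //.
  by rewrite addnACA leq_addr.
rewrite inE negb_forall => /existsP[w]; rewrite negb_imply => /andP[/eqP lw wv].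
by rewrite (bigD1 v) ?lv //= (bigD1 w) /= ?lw ?lv ?eqxx //.
Qed.

Theorem theorem3p1 (G H : sgraph) :
  minn (omega G + #|vertex H|) (omega H + #|vertex G|) <= Psi (join G H) /\
  (Posz (Psi (join G H)) <=
     Num.floor (((omega G)%:R + (omega H)%:R) / 2%:R +
                ((#|vertex G|)%:R + (#|vertex H|)%:R) / 2%:R : rat))%R.
Proof.
split.
  have [le|/ltnW le] := leqP (omega G + #|vertex H|) (omega H + #|vertex G|).
    exact: minn_le_Psi_join.
  exact: leq_trans (minn_le_Psi_join le) (Psi_joinC_le _ _).
have le : (Psi (join G H)).*2 <= (omega G + omega H) + (#|G| + #|H|).
  apply: leq_trans (double_Psi_le _) _.
  by rewrite card_sum addnC leq_add2r omega_join.
rewrite Num.Theory.floor_ge_int -GRing.mulrDl.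
rewrite Num.Theory.ler_pdivlMr ?Num.Theory.ltr0n //.
rewrite -!GRing.natrD pmulrn -GRing.natrM Num.Theory.ler_nat muln2.
exact: le.
Qed.
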